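(* Let $A\in\mathbb{R}^{N\times N}$ be a Stieltjes matrix (a symmetric nonsingular $M$-matrix), let $W_1,\dots,W_p$ be the overlapping coordinate subspaces of $\mathbb{R}^N$ described in the context, and let $q\le p$ be the smallest number of colors such that $W_1,\dots,W_p$ can be colored so that whenever $i\ne j$ and $W_i\cap W_j\neq\{0\}$, $W_i$ and $W_j$ have different colors. For each $i=1,\dots,p$ let $D_i$ be a diagonal matrix with positive diagonal entries (symmetric scaling, $D_i^r=D_i^c=D_i$), let $\mu>0$, and put $$\mathcal{A}_i=\mu D_iA_iD_i,\qquad \tilde{\mathcal{A}}_i=\mathrm{round}_{Mmtrx}(\mathcal{A}_i,u_\ell),\qquad \mathtt{F}_i=\tilde{\mathcal{A}}_i-\mathcal{A}_i,\qquad \tilde{A}_i=\mu^{-1}D_i^{-1}\tilde{\mathcal{A}}_iD_i^{-1},$$ where $A_i=R_iAR_i^T$ and $\mathrm{round}_{Mmtrx}(\cdot,u_\ell)$ is the sign-informed rounding to the lower precision $u_\ell$ defined in the context. Assume that for every $i=1,\dots,p$ $$\rho(\mathcal{A}_i^{-1}\mathtt{F}_i)<1,\qquad \mathcal{A}_i^{-1}\ \ge\ \mathcal{A}_i^{-1}\mathtt{F}_i\mathcal{A}_i^{-1}\ \text{ (entrywise)},\qquad \lambda_{min}(\mathcal{A}_i)\ \ge\ 2\,|\lambda_{-\infty}(\mathtt{F}_i)|,$$ where $\lambda_{min}(\mathcal{A}_i)>0$ is the smallest eigenvalue of $\mathcal{A}_i$ and $\lambda_{-\infty}(\mathtt{F}_i)$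 is the smallest eigenvalue of the symmetric matrix $\mathtt{F}_i$ on the real line (not in absolute value). Let $\tilde{T}_{AS,\theta}$ and $\tilde{T}_{MS}$ be the iteration matrices of the multiprecision damped additive and multiplicative Schwarz methods, obtained by replacing each $A_i^{-1}$ by $\tilde{A}_i^{-1}$ (formulas in the context). Then $$\rho(\tilde{T}_{MS})<1\qquad\text{and}\qquad \rho(\tilde{T}_{AS,\theta})<1\ \text{ for every } 0<\theta<1/q,$$ i.e. the multiprecision versions of these Schwarz methods are convergent.
   Context: Inequalities between matrices are entrywise; $\rho(\cdot)$ denotes spectral radius. A matrix $A\in\mathbb{R}^{N\times N}$ is a (nonsingular) $M$-matrix if it is nonsingular, its off-diagonal entries are non-positive, and $A^{-1}\ge 0$. A Stieltjes matrix is a symmetric nonsingular $M$-matrix (such matrices are symmetric positive definite). Subspaces and restrictions. $\overline{W}_1,\dots,\overline{W}_p$ are subspaces of $\mathbb{R}^N$, each spanned by a subset of the standard basis vectors, with $\mathbb{R}^N=\sum_i\overline{W}_i$ and $\overline{W}_i\cap\overline{W}_j=\{0\}$ for $i\ne j$. $W_i\supset\overline{W}_i$ are (larger) subspaces, also each spanned by standard basis vectors; $N_i=\dim W_i\ge\dim\overline{W}_i$ and $\sum_iN_i>N$. $R_i\in\mathbb{R}^{N_i\times N}$ is the zero-one restriction matrix $[I_{N_i}\ 0]\Pi_i$ ($\Pi_i$ a permutation matrix) whose rows are the (transposed) standard basis vectors spanning $W_i$. The subdomain matrices are $A_i=R_iAR_i^T\in\mathbb{R}^{N_i\times N_i}$.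 Rounding. A precision $u_\ell$ comes with a set of representable real numbers, containing $0$ and symmetric about $0$. $\mathtt{rd}_{u_\ell}(x)$ rounds $x$ towards zero: for $x>0$ it is the largest representable number $\le x$, and for $x<0$ the smallest representable number $\ge x$. $\mathtt{ru}_{u_\ell}(x)$ rounds $x$ away from zero (towards plus/minus infinity): for $x>0$ it is the smallest representable number $\ge x$, and for $x<0$ the largest representable number $\le x$. It is assumed that the scaled matrices $\mathcal{A}_i$ have entries within the range of the precision, so these roundings are defined (no overflow). For a matrix $X$, $$(\mathrm{round}_{Mmtrx}(X,u_\ell))_{mn}=\begin{cases}\mathtt{ru}_{u_\ell}(X_{mn}),&X_{mn}>0,\\ \mathtt{rd}_{u_\ell}(X_{mn}),&X_{mn}<0,\\ 0,&X_{mn}=0.\end{cases}$$ Since the rounding acts entrywise, $\tilde{\mathcal{A}}_i$ and $\mathtt{F}_i$ are symmetric. The effect of the lower precision is modelled solely by replacing $A_i^{-1}$ with $\tilde{A}_i^{-1}$; everything else is in exact arithmetic. Iteration matrices. With $I_N$ the identity, $$\tilde{T}_{AS,\theta}=I_N-\theta\sum_{i=1}^pR_i^T\tilde{A}_i^{-1}R_iA,$$ $$\tilde{T}_{MS}=(I_N-R_p^T\tilde{A}_p^{-1}R_pA)(I_N-R_{p-1}^T\tilde{A}_{p-1}^{-1}R_{p-1}A)\cdots(I_N-R_1^T\tilde{A}_1^{-1}R_1A).$$ *)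

(* Defs.v *)
From HB Require Import structures.
From mathcomp Require Import all_boot all_order all_fingroup all_algebra.
From mathcomp Require Import boolp classical_sets reals.
From mathcomp Require Import complex.

Set Implicit Arguments.
Unset Strict Implicit.
Unset Printing Implicit Defensive.

Import Order.TTheory GRing.Theory Num.Theory.

Local Open Scope classical_set_scope.
Local Open Scope ring_scope.

Definition le_mx (R : realType) (m n : nat) (A B : 'M[R]_(m, n)) : Prop :=
  forall i j, A i j <= B i j.

Definition M_matrix (R : realType) (n : nat) (A : 'M[R]_n) : Prop :=
  [/\ A \in unitmx,
      forall i j, i != j -> A i j <= 0
    & le_mx 0 (invmx A)].

Definition Stieltjes (R : realType) (n : nat) (A : 'M[R]_n) : Prop :=
  A^T = A /\ M_matrix A.

(* The eigenvalues of a real matrix are taken in R[i]; the supremum is over a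
   finite set, hence a maximum (and 0 for the empty matrix). *)
Definition spectral_radius (R : realType) (n : nat) (M : 'M[R]_n) : R :=
  sup [set complex.Re `|z| |
       z in [set z : R[i] | eigenvalue (map_mx (real_complex R) M) z]].

(* Only meaningful for matrices with a real eigenvalue, such as symmetric
   matrices of positive size; it is 0 for the empty matrix. *)
Definition lambda_min (R : realType) (n : nat) (M : 'M[R]_n) : R :=
  inf [set x : R | eigenvalue M x].

Definition coordinate_subspace (R : realType) (N : nat)
    (V : {vspace 'cV[R]_N}) : Prop :=
  exists S : {set 'I_N}, V = <<[seq delta_mx i ord0 | i in S]>>%VS.

(* R_V = [I 0] * Pi with Pi a permutation matrix, the transposed rows of R_V
   spanning V. *)
Definition restriction_matrix (R : realType) (N : nat)
    (V : {vspace 'cV[R]_N}) (RV : 'M[R]_(\dim V, N)) : Prop :=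
  (exists s : 'S_N, RV = pid_mx (\dim V) *m perm_mx s) /\
  V = <<[seq (row k RV)^T | k : 'I_(\dim V)]>>%VS.

Definition overlapping_decomposition (R : realType) (N p : nat)
    (barW W : 'I_p -> {vspace 'cV[R]_N}) : Prop :=
  [/\ forall i, coordinate_subspace (barW i),
      (\sum_i barW i)%VS = fullv
    & forall i j, i != j -> (barW i :&: barW j)%VS = 0%VS] /\
  [/\ forall i, coordinate_subspace (W i),
      forall i, (barW i <= W i)%VS
    & (N < \sum_i \dim (W i))%N].

Definition colorable (R : realType) (N p : nat)
    (W : 'I_p -> {vspace 'cV[R]_N}) (k : nat) : Prop :=
  exists c : 'I_p -> 'I_k,
    forall i j, i != j -> (W i :&: W j)%VS != 0%VS -> c i != c j.

Definition smallest_number_of_colors (R : realType) (N p : nat)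
    (W : 'I_p -> {vspace 'cV[R]_N}) (q : nat) : Prop :=
  colorable W q /\ forall k, colorable W k -> (q <= k)%N.

(* A precision is given by its set of representable numbers. *)
Definition precision (R : realType) (u : set R) : Prop :=
  u 0 /\ forall x, u x -> u (- x).

Definition largest (R : realType) (S : set R) : set R := S `&` ubound S.

Definition smallest (R : realType) (S : set R) : set R := S `&` lbound S.

Definition representable_le (R : realType) (u : set R) (x : R) : set R :=
  [set y | u y /\ y <= x].

Definition representable_ge (R : realType) (u : set R) (x : R) : set R :=
  [set y | u y /\ x <= y].

(* x has a nearest representable number on either side (no overflow), so that
   the choices made by xget in rd and ru below are not the default one. *)
Definition in_range (R : realType) (u : set R) (x : R) : Prop :=
  (exists y, largest (representable_le u x) y) /\
  (exists y, smallest (representable_ge u x) y).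

Definition rd (R : realType) (u : set R) (x : R) : R :=
  if 0 < x then xget 0 (largest (representable_le u x))
  else if x < 0 then xget 0 (smallest (representable_ge u x))
  else 0.

Definition ru (R : realType) (u : set R) (x : R) : R :=
  if 0 < x then xget 0 (smallest (representable_ge u x))
  else if x < 0 then xget 0 (largest (representable_le u x))
  else 0.

Definition round_Mmtrx (R : realType) (m n : nat) (X : 'M[R]_(m, n))
    (u : set R) : 'M[R]_(m, n) :=
  \matrix_(i, j) (if 0 < X i j then ru u (X i j)
                  else if X i j < 0 then rd u (X i j)
                  else 0).

Definition scaling_matrix (R : realType) (n : nat) (D : 'M[R]_n) : Prop :=
  is_diag_mx D /\ forall k, 0 < D k k.

(* The rows of Rs i are indexed by 'I_(n i), with n i the dimension of the i-th
   subspace, and At i is the matrix whose inverse is used on it. *)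
Definition T_AS (R : realType) (N p : nat) (A : 'M[R]_N) (n : 'I_p -> nat)
    (Rs : forall i, 'M[R]_(n i, N)) (At : forall i, 'M[R]_(n i))
    (theta : R) : 'M[R]_N :=
  1%:M - theta *: \sum_i (Rs i)^T *m invmx (At i) *m Rs i *m A.

(* rev_ord puts the factor of the last subspace leftmost. *)
Definition T_MS (R : realType) (N p : nat) (A : 'M[R]_N) (n : 'I_p -> nat)
    (Rs : forall i, 'M[R]_(n i, N)) (At : forall i, 'M[R]_(n i)) : 'M[R]_N :=
  \big[mulmx/1%:M]_(i < p)
    (1%:M - (Rs (rev_ord i))^T *m invmx (At (rev_ord i)) *m Rs (rev_ord i) *m A).

(* Main.v *)
Require Import Defs.
From mathcomp Require Import all_boot all_order all_fingroup all_algebra.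
From mathcomp Require Import boolp classical_sets reals.
From mathcomp Require Import complex.
From mathcomp Require Import ring lra.

Set Implicit Arguments.
Unset Strict Implicit.
Unset Printing Implicit Defensive.

Import Order.TTheory GRing.Theory Num.Theory.

Local Open Scope ring_scope.

(** Vectors are rows, and for a square matrix M the bilinear form x M y^T is
    written mxform M x y.

    Rounding positive entries up and negative entries towards zero gives, after
    undoing the scaling, local matrices At_i >= A_i entrywise whose
    off-diagonal entries still are non-positive.  Everything rests on a
    comparison of quadratic forms: if A <= M <= 0 off the diagonal and A <= M
    on it, then (2 M - A) y . y >= A |y| . |y| for every y, because the
    off-diagonal entries of 2 M - A are bounded by those of - A in absolute
    value (mxform_compare).  As a Stieltjes matrix A is positive definite
    (Stieltjes_posdef), this makes 2 M - A positive definite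
    (posdef_compare).

    The comparison applies at once to all subdomains of one color.  Put
    y = sum_i R_i^T At_i^-1 R_i x over the subdomains of one color, and let
    M = sum_i R_i^T At_i R_i, whose blocks do not meet.  Then
    x . y = M y . y, hence A y . y < 2 x . y unless y = 0
    (class_correction).

    A left eigenvector of an iteration matrix is moved by steps x -> x - y A,
    and in the norm Q(x) = A^-1 x . x such a step changes the energy by
    - 2 x . y + A y . y (energy_correction).  In the multiplicative method,
    each factor is such a step for a single subdomain, so it either decreases
    Q strictly or fixes x, the latter only if R_i x = 0; as the subdomains
    cover all indices, the whole sweep decreases Q strictly.  In the damped
    additive method the correction is a sum of q class corrections y_c, and
    convexity gives A y . y <= q * sum_c A y_c . y_c <= 2 q x . y, so that
    theta q < 1 again makes Q decrease (mxform_convex).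

    Finally, a real matrix that strictly decreases a positive definite
    quadratic form on every nonzero row has spectral radius less than 1
    (spectral_radius_contraction): add up the energies of the real and
    imaginary parts of a complex left eigenvector. *)

(** * Bilinear forms and positive definite matrices *)

Definition mxform (R : realType) (n : nat) (M : 'M[R]_n) (x y : 'rV[R]_n) : R :=
  (x *m M *m y^T) 0 0.

Definition posdef (R : realType) (n : nat) (M : 'M[R]_n) : Prop :=
  forall x, x != 0 -> 0 < mxform M x x.

Section Forms.
Variables (R : realType) (n : nat).
Implicit Types (M : 'M[R]_n) (x y z : 'rV[R]_n).

Lemma mxformE M x y : mxform M x y = \sum_i \sum_j x 0 i * M i j * y 0 j.
Proof.
rewrite /mxform mxE exchange_big; apply: eq_bigr => j _ /=.
by rewrite !mxE mulr_suml.
Qed.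

Lemma mxform_sym M x y : M^T = M -> mxform M x y = mxform M y x.
Proof.
move=> symM; rewrite /mxform.
have <- : (y *m M *m x^T)^T 0 0 = (y *m M *m x^T) 0 0.
  by rewrite mxE.
by rewrite !trmx_mul trmxK symM mulmxA.
Qed.

Lemma mxformDl M x y z : mxform M (x + y) z = mxform M x z + mxform M y z.
Proof. by rewrite /mxform !mulmxDl mxE. Qed.

Lemma mxformDr M x y z : mxform M z (x + y) = mxform M z x + mxform M z y.
Proof. by rewrite /mxform linearD mulmxDr mxE. Qed.

Lemma mxformZl M a x y : mxform M (a *: x) y = a * mxform M x y.
Proof. by rewrite /mxform -!scalemxAl mxE. Qed.

Lemma mxformZr M a x y : mxform M x (a *: y) = a * mxform M x y.
Proof. by rewrite /mxform linearZ -scalemxAr mxE. Qed.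

Lemma mxformBl M x y z : mxform M (x - y) z = mxform M x z - mxform M y z.
Proof. by rewrite -scaleN1r mxformDl mxformZl mulN1r. Qed.

Lemma mxformBr M x y z : mxform M z (x - y) = mxform M z x - mxform M z y.
Proof. by rewrite -scaleN1r mxformDr mxformZr mulN1r. Qed.

Lemma mxform0l M x : mxform M 0 x = 0.
Proof. by rewrite /mxform !mul0mx mxE. Qed.

Lemma mxform_suml M (I : Type) (r : seq I) (P : pred I) (f : I -> 'rV_n) x :
  mxform M (\sum_(i <- r | P i) f i) x = \sum_(i <- r | P i) mxform M (f i) x.
Proof. by rewrite /mxform !mulmx_suml summxE. Qed.

Lemma mxform_sumr M (I : Type) (r : seq I) (P : pred I) (f : I -> 'rV_n) x :
  mxform M x (\sum_(i <- r | P i) f i) = \sum_(i <- r | P i) mxform M x (f i).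
Proof. by rewrite /mxform linear_sum mulmx_sumr summxE. Qed.

Lemma posdef_ge0 M x : posdef M -> 0 <= mxform M x x.
Proof.
move=> pM; have [->|x0] := eqVneq x 0; first by rewrite mxform0l.
exact/ltW/pM.
Qed.

Lemma posdef_unitmx M : posdef M -> M \in unitmx.
Proof.
move=> pM; rewrite -row_free_unit -kermx_eq0; apply/rowV0P => v /sub_kermxP vM.
apply/eqP/negPn/negP => /pM; by rewrite /mxform vM mul0mx mxE ltxx.
Qed.

Lemma posdef_invmx M : M^T = M -> posdef M -> posdef (invmx M).
Proof.
move=> symM pM x x0; have uM := posdef_unitmx pM.
have -> : mxform (invmx M) x x = mxform M (x *m invmx M) (x *m invmx M).
  by rewrite /mxform mulmxKV // trmx_mul trmx_inv symM mulmxA.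
apply: pM; apply: contra_neq x0 => /(congr1 (mulmx^~ M)).
by rewrite mulmxKV // mul0mx.
Qed.

End Forms.

(** The row sums x of A^-1 form a positive vector with A x = 1, so scaling by x
    makes A strictly diagonally dominant.  For v = x w this dominance is the
    identity
    v A v^T = sum_i x_i w_i^2 - 1/2 sum_ij A_ij x_i x_j (w_i - w_j)^2,
    whose last sum is non-positive. *)
Lemma Stieltjes_posdef (R : realType) (n : nat) (A : 'M[R]_n) :
  Stieltjes A -> posdef A.
Proof.
move=> [symA [uA offA invA]] v v0.
pose x i := \sum_j invmx A i j.
have x0 i : 0 < x i.
  have inv_ge0 j : true -> 0 <= invmx A i j by have := invA i j; rewrite mxE.
  rewrite lt_def sumr_ge0 // andbT; apply/eqP => /(psumr_eq0P inv_ge0) row0.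
  have /matrixP /(_ i i) := mulVmx uA; rewrite !mxE eqxx big1 => [/eqP|j _].
    by rewrite eq_sym oner_eq0.
  by rewrite row0 // mul0r.
have Ax i : \sum_j A i j * x j = 1.
  under eq_bigr do rewrite mulr_sumr.
  rewrite exchange_big /= (eq_bigr (fun k => (1%:M : 'M[R]_n) i k)) => [|k _].
    rewrite (bigD1 i) //= mxE eqxx big1 ?addr0 // => k ki.
    by rewrite mxE eq_sym (negbTE ki).
  by rewrite -(mulmxV uA) mxE.
pose w i := v 0 i / x i.
have vE i : v 0 i = x i * w i by rewrite mulrC divfK // gt_eqF.
(* Uses 2 w_i w_j = w_i^2 + w_j^2 - (w_i - w_j)^2 and the sign of A_ij. *)
have key i j : A i j * (x i * x j * (w i ^+ 2 + w j ^+ 2)) <=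
    2 * (v 0 i * A i j * v 0 j).
  rewrite !vE; have [->|/offA Aij] := eqVneq i j.
    by rewrite le_eqVlt; apply/orP; left; apply/eqP; ring.
  have xx : 0 < x i * x j by rewrite mulr_gt0.
  have : A i j * (x i * x j * (w i - w j) ^+ 2) <= 0.
    by rewrite mulr_le0_ge0 // mulr_ge0 ?sqr_ge0 // ltW.
  set d := A i j * _; rewrite -subr_ge0 => d0; rewrite -subr_ge0.
  by rewrite (_ : _ - _ = 0 - d) // /d; ring.
have sum_w : \sum_i \sum_j A i j * (x i * x j * (w i ^+ 2 + w j ^+ 2)) =
    2 * \sum_i x i * w i ^+ 2.
  have half : \sum_i \sum_j A i j * (x i * x j * w i ^+ 2) =
      \sum_i x i * w i ^+ 2.
    apply: eq_bigr => i _.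
    rewrite -[RHS]mulr1 -(Ax i) mulr_sumr; apply: eq_bigr => j _; ring.
  have -> : 2 * \sum_i x i * w i ^+ 2 =
      \sum_i x i * w i ^+ 2 + \sum_i x i * w i ^+ 2 by ring.
  rewrite -{1}half -half [X in _ + X]exchange_big -big_split.
  apply: eq_bigr => i _; rewrite -big_split; apply: eq_bigr => j _ /=.
  by rewrite -[in A j i]symA mxE; ring.
have : 2 * \sum_i x i * w i ^+ 2 <= 2 * mxform A v v.
  rewrite -sum_w mxformE mulr_sumr; apply: ler_sum => i _.
  by rewrite mulr_sumr; apply: ler_sum => j _.
rewrite ler_pM2l //; apply: lt_le_trans.
have /rV0Pn[i vi] := v0.
rewrite (bigD1 i) //= ltr_wpDr ?sumr_ge0 // => [j _|].
  by rewrite mulr_ge0 ?sqr_ge0 // ltW.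
by rewrite mulr_gt0 // exprn_even_gt0 //= mulf_neq0 // invr_eq0 gt_eqF.
Qed.

(** The inequality holds term by term: off the diagonal, 2 M - A lies between A
    and - A.  The diagonal is compared only on the support of y, so that M may
    vanish outside the subdomains on which y is supported. *)
Lemma mxform_compare (R : realType) (n : nat) (A M : 'M[R]_n) (y : 'rV[R]_n) :
  (forall i j, i != j -> A i j <= M i j <= 0) ->
  (forall i, y 0 i != 0 -> A i i <= M i i) ->
  mxform A (map_mx Num.norm y) (map_mx Num.norm y) <=
  2 * mxform M y y - mxform A y y.
Proof.
move=> off dia; rewrite !mxformE mulr_sumr -sumrB; apply: ler_sum => i _.
rewrite mulr_sumr -sumrB; apply: ler_sum => j _; rewrite !mxE.
have [<-|/off/andP[AM M0]] := eqVneq i j.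
  have [->|/dia AM] := eqVneq (y 0 i) 0.
    by rewrite normr0 !mul0r mulr0 subr0.
  have yy : `|y 0 i| * `|y 0 i| = y 0 i * y 0 i.
    by rewrite -!expr2 real_normK ?num_real.
  rewrite mulrAC yy -subr_ge0.
  have -> : 2 * (y 0 i * M i i * y 0 i) - y 0 i * A i i * y 0 i
      - y 0 i * y 0 i * A i i =
    2 * ((M i i - A i i) * y 0 i ^+ 2) by ring.
  by rewrite mulr_ge0 // mulr_ge0 ?subr_ge0 ?sqr_ge0.
have -> : `|y 0 i| * A i j * `|y 0 j| = A i j * `|y 0 i * y 0 j|.
  by rewrite normrM; ring.
have -> : 2 * (y 0 i * M i j * y 0 j) - y 0 i * A i j * y 0 j =
  (2 * M i j - A i j) * (y 0 i * y 0 j) by ring.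
have [p0|p0] := leP 0 (y 0 i * y 0 j).
  by rewrite ger0_norm // ler_wpM2r //; lra.
by have := mulr_le0 M0 (ltW p0); rewrite ltr0_norm //; lra.
Qed.

Lemma posdef_compare (R : realType) (n : nat) (A M : 'M[R]_n) (y : 'rV[R]_n) :
  posdef A ->
  (forall i j, i != j -> A i j <= M i j <= 0) ->
  (forall i, y 0 i != 0 -> A i i <= M i i) ->
  y != 0 -> mxform A y y < 2 * mxform M y y.
Proof.
move=> pA off dia y0; rewrite -subr_gt0.
apply: lt_le_trans (mxform_compare off dia); apply: pA.
have /rV0Pn[i yi] := y0; apply/rV0Pn; exists i.
by rewrite mxE normr_eq0.
Qed.

(** * Spectral radius of a contraction *)

(** Each eigenvalue being inside the unit disk bounds the supremum strictly
    because the eigenvalues are the finitely many roots of the characteristic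
    polynomial. *)
Lemma spectral_radius_lt1 (R : realType) (n : nat) (T : 'M[R]_n) :
  (forall z, eigenvalue (map_mx (real_complex R) T) z -> `|z| < 1) ->
  spectral_radius T < 1.
Proof.
move=> Tz; rewrite /spectral_radius; set E := [set _ | _ in _]%classic.
have E1 x : E x -> x < 1.
  by move=> [z /Tz z1 <-]; move: z1; rewrite ltcE /= => /andP[].
have [->|/set0P E0] := eqVneq E classical_sets.set0; first by rewrite sup0.
suff [c c1 Ec] : exists2 c, c < 1 & forall x, E x -> x <= c.
  by apply: le_lt_trans c1; apply: ge_sup.
have [r charE] :=
  closed_field_poly_normal (char_poly (map_mx (real_complex R) T)).
suff [c c1 rc] : exists2 c : R,
    c < 1 & forall z, z \in r -> complex.Re `|z| < 1 -> complex.Re `|z| <= c.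
  exists c => // x Ex; move: (Ex) => [z /= zT <-]; apply: rc; last first.
    by apply: E1; exists z.
  move: zT; rewrite eigenvalue_root_char charE rootZ ?root_prod_XsubC //.
  by rewrite lead_coef_eq0 monic_neq0 // char_poly_monic.
elim: r {charE} => [|z r [c c1 rc]]; first by exists 0.
have [z1|z1] := ltP (complex.Re `|z|) 1; last first.
  exists c => // t; rewrite inE => /predU1P[->|/rc//].
  by rewrite ltNge z1.
exists (Num.max c (complex.Re `|z|)); first by rewrite gt_max c1 z1.
move=> t; rewrite inE => /predU1P[->|/rc tc /tc]; rewrite le_max ?lexx ?orbT //.
by move->.
Qed.

(** If v = x + i y is a left eigenvector for z, the cross terms in the energies
    of x T and y T cancel, and their sum is |z|^2 times that of x and y. *)
Lemma spectral_radius_contraction (R : realType) (n : nat) (G T : 'M[R]_n) :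
  G^T = G -> posdef G ->
  (forall x, x != 0 -> mxform G (x *m T) (x *m T) < mxform G x x) ->
  spectral_radius T < 1.
Proof.
move=> symG pG contr; apply: spectral_radius_lt1 => z /eigenvalueP[v vT v0].
pose x := map_mx (@complex.Re R) v; pose y := map_mx (@complex.Im R) v.
pose a := complex.Re z; pose b := complex.Im z.
have vE j : v 0 j = (x 0 j +i* y 0 j)%C by rewrite !mxE; case: (v 0 j).
have sumC (f : 'I_n -> R[i]) :
  \sum_i f i = ((\sum_i complex.Re (f i)) +i* (\sum_i complex.Im (f i)))%C.
  by apply: (big_ind3 (fun s t w => s = (t +i* w)%C)) => // [|i _];
    [move=> ? ? ? ? ? ? -> ->|case: (f i)].
have vTj j : ((x *m T) 0 j +i* (y *m T) 0 j)%C =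
    ((a * x 0 j - b * y 0 j) +i* (a * y 0 j + b * x 0 j))%C.
  move/rowP/(_ j): vT; rewrite !mxE sumC => vT.
  have -> : ((a * complex.Re (v 0 j) - b * complex.Im (v 0 j)) +i*
      (a * complex.Im (v 0 j) + b * complex.Re (v 0 j)))%C = z * v 0 j.
    by rewrite /a /b; case: (z) (v 0 j) => [? ?] [? ?].
  rewrite -vT; congr Complex; apply: eq_bigr => k _; rewrite !mxE;
    case: (v 0 k) => ? ? /=; ring.
have xT : x *m T = a *: x - b *: y.
  by apply/rowP => j; have [-> _] := vTj j; rewrite !mxE.
have yT : y *m T = a *: y + b *: x.
  by apply/rowP => j; have [_ ->] := vTj j; rewrite !mxE.
have QE : mxform G (x *m T) (x *m T) + mxform G (y *m T) (y *m T) =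
    (a ^+ 2 + b ^+ 2) * (mxform G x x + mxform G y y).
  rewrite xT yT !(mxformBl, mxformDl, mxformBr, mxformDr, mxformZl, mxformZr).
  rewrite (mxform_sym y x symG); ring.
have Qle t : mxform G (t *m T) (t *m T) <= mxform G t t.
  have [->|/contr/ltW//] := eqVneq t 0; by rewrite mul0mx.
have Qlt : (a ^+ 2 + b ^+ 2) * (mxform G x x + mxform G y y) <
    mxform G x x + mxform G y y.
  rewrite -QE; have [x0|x0] := eqVneq x 0; last first.
    by rewrite ltr_leD ?Qle // contr.
  rewrite ler_ltD ?Qle // contr //; apply: contra_neq v0 => y0.
  by apply/rowP => j; rewrite vE x0 y0 !mxE.
have Qge := addr_ge0 (posdef_ge0 x pG) (posdef_ge0 y pG).
have ab1 : a ^+ 2 + b ^+ 2 < 1.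
  rewrite ltNge; apply/negP => ab; move: Qlt; rewrite ltNge; nra.
rewrite -(@expr_lt1 _ 2) ?normr_ge0 // -add_Re2_Im2 -/a -/b.
by rewrite -(rmorph1 (real_complex R)) ltcR.
Qed.

(** * Restriction to a set of coordinates *)

Section Selection.
Variables (R : realType) (N n : nat) (f : 'I_n -> 'I_N) (S : 'M[R]_(n, N)).
Hypothesis SE : S = rowsub f 1%:M.

Lemma selection_mulmx m (A : 'M_(N, m)) : S *m A = rowsub f A.
Proof. by rewrite SE -rowsubE. Qed.

Lemma mulmx_trselection m (A : 'M_(m, N)) : A *m S^T = colsub f A.
Proof. by rewrite SE trmx_mxsub trmx1 mulmx_colsub mulmx1. Qed.

Lemma selection_conjE (A : 'M_N) k l : (S *m A *m S^T) k l = A (f k) (f l).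
Proof. by rewrite mulmx_trselection selection_mulmx !mxE. Qed.

Lemma mxform_lift (X : 'M_n) x : mxform (S^T *m X *m S) x x =
  mxform X (x *m S^T) (x *m S^T).
Proof. by rewrite /mxform trmx_mul trmxK !mulmxA. Qed.

Lemma mxform_restrict (A : 'M_N) z : mxform (S *m A *m S^T) z z =
  mxform A (z *m S) (z *m S).
Proof. by rewrite /mxform trmx_mul !mulmxA. Qed.

Lemma lift_out (X : 'M_n) i j :
  ~~ [exists k, f k == i] || ~~ [exists k, f k == j] -> (S^T *m X *m S) i j = 0.
Proof.
rewrite !negb_exists SE => /orP[/forallP out|/forallP out].
  rewrite -mulmxA mxE big1 // => k _.
  by rewrite !mxE (negbTE (out k)) mul0r.
by rewrite mxE big1 // => k _; rewrite !mxE (negbTE (out k)) mulr0.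
Qed.

Hypothesis f_inj : injective f.

Lemma selection_trK : S *m S^T = 1%:M.
Proof.
apply/matrixP => k l; rewrite mulmx_trselection SE !mxE.
by rewrite (inj_eq f_inj).
Qed.

Lemma lift_in (X : 'M_n) k l : (S^T *m X *m S) (f k) (f l) = X k l.
Proof.
rewrite -selection_conjE !mulmxA selection_trK mul1mx.
by rewrite -mulmxA selection_trK mulmx1.
Qed.

Lemma posdef_restrict (A : 'M_N) : posdef A -> posdef (S *m A *m S^T).
Proof.
move=> pA z z0; rewrite mxform_restrict; apply: pA; apply: contra_neq z0.
by move=> /(congr1 (mulmx^~ S^T)); rewrite -mulmxA selection_trK mulmx1 mul0mx.
Qed.

End Selection.

(** * Schwarz corrections *)

(** Expand the nonnegative sum of A (y_c - y_d) . (y_c - y_d) over all pairs. *)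
Lemma mxform_convex (R : realType) (N q : nat) (A : 'M[R]_N)
    (y : 'I_q -> 'rV[R]_N) : A^T = A -> posdef A ->
  mxform A (\sum_c y c) (\sum_c y c) <= q%:R * \sum_c mxform A (y c) (y c).
Proof.
move=> symA pA.
have : 0 <= \sum_(c < q) \sum_(d < q) mxform A (y c - y d) (y c - y d).
  by apply: sumr_ge0 => c _; apply: sumr_ge0 => d _; apply: posdef_ge0.
have -> : \sum_(c < q) \sum_(d < q) mxform A (y c - y d) (y c - y d) =
    \sum_(c < q) \sum_(d < q) mxform A (y c) (y c)
    + \sum_(c < q) \sum_(d < q) mxform A (y d) (y d)
    - 2 * \sum_(c < q) \sum_(d < q) mxform A (y c) (y d).
  rewrite mulr_sumr -big_split -sumrB; apply: eq_bigr => c _.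
  rewrite mulr_sumr -big_split -sumrB; apply: eq_bigr => d _ /=.
  rewrite !(mxformBl, mxformBr) (mxform_sym (y d) _ symA); ring.
rewrite [X in _ + X - _]exchange_big /=.
have -> : \sum_(c < q) \sum_(d < q) mxform A (y c) (y c) =
    q%:R * \sum_c mxform A (y c) (y c).
  rewrite mulr_sumr; apply: eq_bigr => c _.
  by rewrite sumr_const card_ord mulr_natl.
have -> : \sum_(c < q) \sum_(d < q) mxform A (y c) (y d) =
    mxform A (\sum_c y c) (\sum_c y c).
  by rewrite mxform_suml; apply: eq_bigr => c _; rewrite mxform_sumr.
lra.
Qed.

Section Schwarz.
Variables (R : realType) (N p : nat) (A : 'M[R]_N).
Hypotheses (symA : A^T = A) (pA : posdef A).
Hypothesis offA : forall i j, i != j -> A i j <= 0.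
Variables (n : 'I_p -> nat) (f : forall i, 'I_(n i) -> 'I_N).
Variables (S : forall i, 'M[R]_(n i, N)) (At : forall i, 'M[R]_(n i)).
Hypothesis f_inj : forall i, injective (@f i).
Hypothesis SE : forall i, S i = rowsub (@f i) 1%:M.
Hypothesis At_ge : forall i k l, A (f k) (f l) <= At i k l.
Hypothesis At_le0 : forall i k l, k != l -> At i k l <= 0.

(** The local matrix 2 At_i - A_i is positive definite by comparison, and
    so is A_i: their sum is 2 At_i. *)
Lemma At_posdef i : posdef (At i).
Proof.
move=> z z0; have pAi := posdef_restrict (SE i) (@f_inj i) pA.
have AiE := selection_conjE (SE i) A.
have : mxform (S i *m A *m (S i)^T) z z < 2 * mxform (At i) z z.
  by apply: posdef_compare => // [k l kl|k _]; rewrite AiE ?At_ge ?At_le0.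
by move=> /(lt_trans (pAi _ z0)); rewrite pmulr_rgt0.
Qed.

(** The correction is the row whose image under A the solve on subdomain i
    subtracts from x. *)
Definition correction i (x : 'rV[R]_N) : 'rV[R]_N :=
  x *m (S i)^T *m invmx (At i) *m S i.

Let z i (x : 'rV[R]_N) := x *m (S i)^T *m invmx (At i).

Lemma mxform1_correction i x : mxform 1%:M x (correction i x) =
  mxform (At i) (z i x) (z i x).
Proof.
rewrite /mxform mulmx1 /correction -/(z i x) {2}/z mulmxKV ?posdef_unitmx //.
  by rewrite trmx_mul mulmxA.
exact: At_posdef.
Qed.

Lemma mxform1_correction_ge0 i x : 0 <= mxform 1%:M x (correction i x).
Proof. by rewrite mxform1_correction; apply/posdef_ge0/At_posdef. Qed.

Lemma mxform1_correction_eq0 i x : mxform 1%:M x (correction i x) = 0 ->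
  x *m (S i)^T = 0.
Proof.
rewrite mxform1_correction => zz0.
have uAt := posdef_unitmx (@At_posdef i).
have z0 : z i x = 0.
  by apply/eqP/negPn/negP => /(@At_posdef i); rewrite zz0 ltxx.
by rewrite -[LHS](mulmxKV uAt) -/(z i x) z0 mul0mx.
Qed.

Definition disjoint_class (C : pred 'I_p) :=
  forall i j (k : 'I_(n i)) (l : 'I_(n j)), C i -> C j -> i != j -> f k != f l.

(** The subdomains of C need not be orthogonal for A: their coupling is bounded
    together with the rounding error, by comparing A with the block matrix M
    assembled from all At_i at once. *)
Lemma class_correction C x : disjoint_class C ->
  let y := \sum_(i | C i) correction i x in
  y != 0 -> mxform A y y < 2 * mxform 1%:M x y.
Proof.
move=> disC y y0.
pose M := \sum_(i | C i) (S i)^T *m At i *m S i.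
have SS i j : C i -> C j -> i != j -> S j *m (S i)^T = 0.
  move=> Ci Cj ij; apply/matrixP => k l.
  rewrite (mulmx_trselection (SE i)) SE !mxE.
  by rewrite (negbTE (disC j i k l _ _ _)) // eq_sym.
have yS i : C i -> y *m (S i)^T = z i x.
  move=> Ci; rewrite mulmx_suml (bigD1 i) //= big1 => [|j /andP[Cj ji]].
    by rewrite -mulmxA (selection_trK (SE i) (@f_inj i)) mulmx1 addr0.
  by rewrite -mulmxA SS // 1?eq_sym // mulmx0.
have -> : mxform 1%:M x y = mxform M y y.
  have -> : mxform M y y = \sum_(i | C i) mxform ((S i)^T *m At i *m S i) y y.
    by rewrite /mxform mulmx_sumr mulmx_suml summxE.
  rewrite mxform_sumr; apply: eq_bigr => i Ci.
  by rewrite mxform1_correction mxform_lift yS.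
have ME i a b (k : 'I_(n i)) : C i -> f k = a ->
    M a b = ((S i)^T *m At i *m S i) a b.
  move=> Ci <-; rewrite summxE (bigD1 i) //= big1 ?addr0 // => j' /andP[Cj ji].
  apply: (lift_out (SE j')); apply/orP; left; rewrite negb_exists.
  by apply/forallP => l; apply: disC.
(* An index in no subdomain of C has zero row and column in M, and a zero
   entry in y. *)
have cover a : (exists i (k : 'I_(n i)), C i /\ f k = a) \/
    (forall i, C i -> ~~ [exists k : 'I_(n i), f k == a]).
  have [[i Ci]|no] :=
    pselect (exists2 i, C i & [exists k : 'I_(n i), f k == a]).
    by move=> /existsP[k /eqP fk]; left; exists i, k.
  by right=> i Ci; apply/negP => ex; apply: no; exists i.
apply: posdef_compare => // [a b ab|a].
  case: (cover a) => [[i [k [Ci fk]]]|out]; last first.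
    rewrite summxE big1 => [|i Ci]; first by rewrite offA ?lexx.
    by rewrite (lift_out (SE i)) // out.
  rewrite (ME i a b k) //.
  have [/existsP[l /eqP fl]|nob] := boolP [exists l : 'I_(n i), f l == b].
    move: ab; rewrite -fk -fl (lift_in (SE i)) // At_ge => /= kl.
    by apply: At_le0; apply: contraNneq kl => ->.
  by rewrite (lift_out (SE i)) ?nob ?orbT // offA ?lexx.
case: (cover a) => [[i [k [Ci fk]]] _|out /eqP[]].
  by rewrite (ME i a a k) // -fk (lift_in (SE i)) // At_ge.
rewrite summxE big1 // => i Ci; rewrite mxE big1 // => k _.
rewrite SE !mxE; have := out i Ci; rewrite negb_exists => /forallP/(_ k).
by move/negbTE->; rewrite mulr0.
Qed.

(** * Convergence of both iterations *)

Lemma energy_correction (x y : 'rV[R]_N) :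
  mxform (invmx A) (x - y *m A) (x - y *m A) =
  mxform (invmx A) x x - 2 * mxform 1%:M x y + mxform A y y.
Proof.
have uA := posdef_unitmx pA.
have symG : (invmx A)^T = invmx A by rewrite trmx_inv symA.
rewrite !(mxformBl, mxformBr) (mxform_sym (y *m A) x symG).
have -> : mxform (invmx A) x (y *m A) = mxform 1%:M x y.
  by rewrite /mxform trmx_mul symA mulmxA mulmxKV // mulmx1.
have -> : mxform (invmx A) (y *m A) (y *m A) = mxform A y y.
  by rewrite /mxform mulmxK // trmx_mul symA mulmxA.
ring.
Qed.

Hypothesis S_cover : forall x : 'rV[R]_N, (forall i, x *m (S i)^T = 0) -> x = 0.

Lemma T_MS_lt1 : spectral_radius (T_MS A S At) < 1.
Proof.
have symG : (invmx A)^T = invmx A by rewrite trmx_inv symA.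
apply: (spectral_radius_contraction symG (posdef_invmx symA pA)) => x x0.
set Q := mxform (invmx A).
pose E i := 1%:M - (S i)^T *m invmx (At i) *m S i *m A.
have xE i t : t *m E i = t - correction i t *m A.
  by rewrite mulmxBr mulmx1 /correction !mulmxA.
have step i t : t *m E i = t /\ t *m (S i)^T = 0 \/
    Q (t *m E i) (t *m E i) < Q t t.
  have [y0|y0] := eqVneq (correction i t) 0.
    left; rewrite xE y0 mul0mx subr0; split=> //.
    by apply: mxform1_correction_eq0; rewrite y0 /mxform trmx0 mulmx0 mxE.
  right; rewrite xE /Q energy_correction.
  have : mxform A (correction i t) (correction i t) <
      2 * mxform 1%:M t (correction i t).
    have := @class_correction (pred1 i) t; rewrite /= big_pred1_eq; apply=> //.
    by move=> j k l m /eqP ji /eqP ki /eqP[]; rewrite ji ki.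
  lra.
(* Induction on the list of factors keeps track of the alternative: either no
   factor has moved t, or the energy has strictly dropped. *)
suff: forall r t, t *m \big[mulmx/1%:M]_(i <- r) E i = t /\
      (forall i, i \in r -> t *m (S i)^T = 0) \/
    Q (t *m \big[mulmx/1%:M]_(i <- r) E i)
      (t *m \big[mulmx/1%:M]_(i <- r) E i) < Q t t.
  move=> /(_ (map (@rev_ord p) (index_enum 'I_p)) x).
  rewrite big_map => -[[_ xS]|//].
  case/eqP: x0; apply: S_cover => i; apply: xS.
  by apply/mapP; exists (rev_ord i); rewrite ?rev_ordK // mem_index_enum.
elim=> [|i r IH] t; first by left; rewrite big_nil mulmx1.
rewrite big_cons mulmxA; have [[tE tS]|lt] := step i t.
  rewrite tE; have [[tr rS]|] := IH t; last by right.
  by left; split=> // j; rewrite inE => /predU1P[->|/rS].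
right; have [[->]|] := IH (t *m E i); first by [].
by move/lt_trans; apply.
Qed.

Lemma T_AS_lt1 q (c : 'I_p -> 'I_q) theta :
  (forall i j (k : 'I_(n i)) (l : 'I_(n j)), i != j ->
    c i = c j -> f k != f l) ->
  0 < theta -> theta * q%:R < 1 ->
  spectral_radius (T_AS A S At theta) < 1.
Proof.
move=> disc theta0 thetaq.
have symG : (invmx A)^T = invmx A by rewrite trmx_inv symA.
apply: (spectral_radius_contraction symG (posdef_invmx symA pA)) => x x0.
pose y := \sum_i correction i x.
have -> : x *m T_AS A S At theta = x - (theta *: y) *m A.
  rewrite mulmxBr mulmx1 -scalemxAr -scalemxAl mulmx_sumr mulmx_suml.
  by congr (_ - _ *: _); apply: eq_bigr => i _; rewrite /correction !mulmxA.
rewrite energy_correction mxformZr mxformZl mxformZr.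
pose yc d := \sum_(i | c i == d) correction i x.
have yE : y = \sum_d yc d by rewrite /y (partition_big c xpredT).
have yc_le d : mxform A (yc d) (yc d) <= 2 * mxform 1%:M x (yc d).
  have [->|/class_correction/ltW] := eqVneq (yc d) 0.
    by rewrite mxform0l /mxform trmx0 mulmx0 mxE mulr0.
  by apply=> i j k l /eqP ci /eqP cj ij; apply: disc; rewrite // ci.
have y_le : mxform A y y <= q%:R * (2 * mxform 1%:M x y).
  rewrite yE (le_trans (mxform_convex _ symA pA)) // ler_wpM2l //.
  by rewrite mxform_sumr mulr_sumr; apply: ler_sum.
have xy_gt0 : 0 < mxform 1%:M x y.
  rewrite mxform_sumr lt_def sumr_ge0 ?andbT => [|i _].
    2: exact: mxform1_correction_ge0.
  apply: contra_neq x0 => /(psumr_eq0P (fun i _ =>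
    mxform1_correction_ge0 i x)) xy0.
  by apply: S_cover => i; apply: mxform1_correction_eq0; apply: xy0.
have : theta * mxform A y y <= theta * q%:R * (2 * mxform 1%:M x y).
  by rewrite -mulrA ler_pM2l.
have : theta * q%:R * (2 * mxform 1%:M x y) < 2 * mxform 1%:M x y.
  by rewrite gtr_pMl // mulr_gt0.
move=> lt /le_lt_trans/(_ lt); rewrite -(ltr_pM2l theta0); lra.
Qed.

End Schwarz.

(** * Entries of the rounded subdomain matrices *)

Lemma round_Mmtrx_ge (R : realType) (u : set R) (m n : nat) (X : 'M[R]_(m, n))
  i j : in_range u (X i j) -> X i j <= round_Mmtrx X u i j.
Proof.
move=> [_ up]; rewrite mxE /ru /rd.
have [X0|X0|<-//] := ltgtP 0 (X i j); by have [[_]] := xgetPex 0 up.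
Qed.

(** As 0 is representable, rounding a negative number towards zero does not
    cross 0. *)
Lemma round_Mmtrx_le0 (R : realType) (u : set R) (m n : nat) (X : 'M[R]_(m, n))
  i j : precision u -> in_range u (X i j) -> X i j <= 0 ->
  round_Mmtrx X u i j <= 0.
Proof.
move=> [u0 _] [_ up] X0; rewrite mxE /rd (ltNge 0) X0 /=.
case: (ltP (X i j) 0) => // _; have [_ lb] := xgetPex 0 up.
by apply: lb; split.
Qed.

Lemma invmx_scaling (R : realType) (n : nat) (D : 'M[R]_n) :
  scaling_matrix D -> invmx D = diag_mx (\row_k (D k k)^-1).
Proof.
move=> [/is_diag_mxP Dd D0].
have DE : D = diag_mx (\row_k D k k).
  apply/matrixP => i j; rewrite !mxE; have [->|ij] := eqVneq i j => //.
  by rewrite Dd.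
have DD : D *m diag_mx (\row_k (D k k)^-1) = 1%:M.
  rewrite {1}DE mulmx_diag; apply/matrixP => i j; rewrite !mxE.
  by have [_|//] := eqVneq i j; rewrite divff // gt_eqF.
have [uD _] := mulmx1_unit DD.
by rewrite -[RHS](mulKmx uD) DD mulmx1.
Qed.

Lemma scaled_conjE (R : realType) (n : nat) (D X : 'M[R]_n) k l :
  is_diag_mx D -> (D *m X *m D) k l = D k k * X k l * D l l.
Proof.
move=> /diag_mxP[d ->]; rewrite mul_diag_mx mul_mx_diag !mxE !eqxx !mulr1n.
by [].
Qed.

Lemma rescaled_round (R : realType) (n : nat) (mu : R) (D X : 'M[R]_n)
    (u : set R) (k l : 'I_n) :
  0 < mu -> scaling_matrix D -> precision u ->
  let calX := mu *: (D *m X *m D) in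
  let Xt := mu^-1 *: (invmx D *m round_Mmtrx calX u *m invmx D) in
  in_range u (calX k l) ->
  X k l <= Xt k l /\ (X k l <= 0 -> Xt k l <= 0).
Proof.
move=> mu0 scD pu calX Xt rng; have [dD D0] := scD.
have calE : calX k l = mu * (D k k * X k l * D l l).
  by rewrite mxE scaled_conjE.
have XtE : Xt k l = mu^-1 * ((D k k)^-1 * round_Mmtrx calX u k l * (D l l)^-1).
  rewrite /Xt invmx_scaling // mxE scaled_conjE ?diag_mx_is_diag //.
  by rewrite ![diag_mx _ _ _]mxE !mxE !eqxx !mulr1n.
have s0 : 0 < mu^-1 * (D k k)^-1 * (D l l)^-1.
  by rewrite !mulr_gt0 // invr_gt0.
have {}XtE : Xt k l = mu^-1 * (D k k)^-1 * (D l l)^-1 * round_Mmtrx calX u k l.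
  by rewrite XtE; ring.
have XE : X k l = mu^-1 * (D k k)^-1 * (D l l)^-1 * calX k l.
  rewrite calE; field; by rewrite !gt_eqF.
rewrite XtE; split; first by rewrite {1}XE ler_pM2l // round_Mmtrx_ge.
move=> X0; rewrite pmulr_rle0 //; apply: round_Mmtrx_le0 => //.
by move: X0; rewrite XE pmulr_rle0.
Qed.

(** * Coordinate subspaces and the convergence theorem *)

Lemma restriction_matrix_rowsub (R : realType) (N : nat)
    (V : {vspace 'cV[R]_N}) (RV : 'M[R]_(\dim V, N)) :
  restriction_matrix RV ->
  exists2 f : 'I_(\dim V) -> 'I_N, injective f & RV = rowsub f 1%:M.
Proof.
move=> [[s ->] _].
have dimV : (\dim V <= N)%N.
  by rewrite (leq_trans (dimvS (subvf V))) // dimvf /dim /= muln1.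
exists (s \o widen_ord dimV).
  by move=> k l /perm_inj/(congr1 val)/= kl; apply: val_inj.
apply/matrixP => k j; rewrite !mxE.
rewrite (bigD1 (widen_ord dimV k)) //= big1 => [|l lk].
  by rewrite !mxE eqxx ltn_ord mul1r addr0 /=.
by rewrite !mxE eq_sym -val_eqE eq_sym /= in lk *; rewrite (negbTE lk) mul0r.
Qed.

Theorem theorem4 (R : realType) (N p q : nat) (A : 'M[R]_N)
    (barW W : 'I_p -> {vspace 'cV[R]_N})
    (Rs : forall i : 'I_p, 'M[R]_(\dim (W i), N))
    (u : set R) (mu : R) (D : forall i : 'I_p, 'M[R]_(\dim (W i)))
    (A_Stieltjes : Stieltjes A)
    (W_decomposition : overlapping_decomposition barW W)
    (Rs_restriction : forall i, restriction_matrix (Rs i))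
    (q_colors : smallest_number_of_colors W q)
    (u_precision : precision u)
    (mu_gt0 : 0 < mu)
    (D_scaling : forall i, scaling_matrix (D i)) :
  let Asub i := Rs i *m A *m (Rs i)^T in
  let calA i := mu *: (D i *m Asub i *m D i) in
  let calAt i := round_Mmtrx (calA i) u in
  let F i := calAt i - calA i in
  let At i := mu^-1 *: (invmx (D i) *m calAt i *m invmx (D i)) in
  (forall i k l, in_range u (calA i k l)) ->
  (forall i, spectral_radius (invmx (calA i) *m F i) < 1) ->
  (forall i, le_mx (invmx (calA i) *m F i *m invmx (calA i))
                   (invmx (calA i))) ->
  (forall i, 2 * `|lambda_min (F i)| <= lambda_min (calA i)) ->
  spectral_radius (T_MS A Rs At) < 1 /\
  (forall theta : R, 0 < theta -> theta < 1 / q%:R ->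
     spectral_radius (T_AS A Rs At theta) < 1).
Proof.
move=> Asub calA calAt F At rng _ _ _.
have pA := Stieltjes_posdef A_Stieltjes.
have [symA [_ offA _]] := A_Stieltjes.
pose fE i := cid2 (restriction_matrix_rowsub (Rs_restriction i)).
pose f i : 'I_(\dim (W i)) -> 'I_N := s2val (fE i).
have f_inj i : injective (@f i) by apply: (s2valP (fE i)).
have RsE i : Rs i = rowsub (@f i) 1%:M by apply: (s2valP' (fE i)).
have AsubE i k l : Asub i k l = A (f i k) (f i l).
  by rewrite /Asub (selection_conjE (RsE i)).
have At_ge i k l : A (f i k) (f i l) <= At i k l.
  by rewrite -AsubE; apply: (rescaled_round mu_gt0 _ _ (rng i k l)).1.
have At_le0 i k l : k != l -> At i k l <= 0.
  move=> kl; apply: (rescaled_round mu_gt0 _ _ (rng i k l)).2 => //.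
  by rewrite -/(Asub i) AsubE offA // (inj_eq (@f_inj i)).
(* A row orthogonal to every W_i vanishes on their sum, the whole space. *)
have W_cover (x : 'rV[R]_N) : (forall i, x *m (Rs i)^T = 0) -> x = 0.
  move=> xR; have [[_ barW_full _] [_ barW_W _]] := W_decomposition.
  have W_ker i : (W i <= lker (linfun (mulmx x : 'cV_N -> 'M_1)))%VS.
    have [_ ->] := Rs_restriction i; apply/span_subvP => _ /mapP[k _ ->].
    by rewrite memv_ker lfunE /= tr_row colE mulmxA xR mul0mx.
  have full_ker : (fullv <= lker (linfun (mulmx x : 'cV_N -> 'M_1)))%VS.
    rewrite -barW_full; apply/subv_sumP => i _.
    exact: subv_trans (barW_W i) (W_ker i).
  apply/rowP => j; have := subvP full_ker (delta_mx j 0) (memvf _).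
  by rewrite memv_ker lfunE /= -colE => /eqP/colP/(_ 0); rewrite !mxE.
(* So subdomains sharing an index meet nontrivially and differ in color. *)
have f_in_W i k : delta_mx (f i k) 0 \in W i.
  have [_ ->] := Rs_restriction i; apply: memv_span.
  apply/mapP; exists k; rewrite ?mem_enum //.
  by rewrite RsE row_rowsub row1 trmx_delta.
have MS := T_MS_lt1 symA pA offA f_inj RsE At_ge At_le0 W_cover.
split; first exact: MS.
move=> theta theta0 thetaq; have [[c c_ok] _] := q_colors.
have q0 : 0 < q%:R :> R.
  rewrite ltr0n lt0n; apply/eqP => q0; move: thetaq.
  by rewrite q0 invr0 mulr0 ltNge (ltW theta0).
apply: (T_AS_lt1 symA pA offA f_inj RsE At_ge At_le0 W_cover (c := c)) => //.
  2: by rewrite -ltr_pdivlMr.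
move=> i j k l ij cij; apply/eqP => fkl.
have /(c_ok i j ij) : (W i :&: W j)%VS != 0%VS; last by rewrite cij eqxx.
apply/eqP => WW; have : delta_mx (f i k) 0 \in (W i :&: W j)%VS.
  by rewrite memv_cap f_in_W fkl f_in_W.
rewrite WW memv0 => /eqP/matrixP/(_ (f i k) 0)/eqP.
by rewrite !mxE !eqxx oner_eq0.
Qed.
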